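(* A connected cluster quiver is $2$-maximal if and only if it is mutation equivalent to an orientation of one of $X_2$, $A_1$, $A_2$, $A_3$, or $A_4$, where $X_2$ is the graph with two vertices and two edges joining them, and $A_m$ is the path graph with $m$ vertices.
   Context: A cluster quiver is a finite quiver (multiple arrows allowed) without loops or oriented 2-cycles; it is connected if its underlying graph is. Its exchange matrix $B(Q)=(b_{ij})$ is the integer skew-symmetric matrix with $b_{ij}$ equal to the number of arrows $i\to j$ minus the number of arrows $j\to i$. The mutation $\mu_k(Q)$ at a vertex $k$ is the cluster quiver whose exchange matrix $(b'_{ij})$ is given by $b'_{ij}=-b_{ij}$ if $i=k$ or $j=k$, and $b'_{ij}=b_{ij}+\mathrm{sgn}(b_{ik})\max\{b_{ik}b_{kj},0\}$ otherwise. Two cluster quivers are mutation equivalent if one is obtained from the other by a finite sequence of mutations (quivers being considered up to relabelling of vertices). The exchange spectrum radius of a cluster quiver is the maximum modulus of the (complex) eigenvalues of its exchange matrix. A cluster quiver $Q$ is $r$-maximal ($r>0$) if every cluster quiver mutation equivalent to $Q$ has exchange spectrum radius at most $r$. An orientation of a graph here means a cluster quiver with that graph as underlying graph (so for $X_2$ both arrows point in the same direction). *)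

(* Defs.v *)
From mathcomp Require Import all_boot all_order all_algebra all_fingroup.
From mathcomp Require Import complex zify.
From mathcomp Require Import boolp classical_sets reals.

Set Implicit Arguments.
Unset Strict Implicit.
Unset Printing Implicit Defensive.

Import Order.TTheory GRing.Theory Num.Theory.

Local Open Scope classical_set_scope.
Local Open Scope ring_scope.

(* A finite quiver on the vertex set {0, ..., n-1}; [arrows Q i j] is the
   number of arrows i -> j. *)
Record cluster_quiver (n : nat) := ClusterQuiver {
  arrows : 'M[nat]_n;
  no_loop : forall i, arrows i i = 0%N;
  no_2cycle : forall i j, arrows i j = 0%N \/ arrows j i = 0%N }.

(* Undirected multigraphs on {0, ..., n-1} are given by their symmetric matrix
   of edge multiplicities. *)
Definition underlying_graph n (Q : cluster_quiver n) : 'M[nat]_n :=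
  \matrix_(i, j) (arrows Q i j + arrows Q j i)%N.

Definition is_orientation n (G : 'M[nat]_n) (Q : cluster_quiver n) : Prop :=
  underlying_graph Q = G.

(* The empty graph is not connected. *)
Definition graph_connected n (G : 'M[nat]_n) : Prop :=
  (0 < n)%N /\ forall i j, connect (fun k l => 0 < G k l)%N i j.

Definition quiver_connected n (Q : cluster_quiver n) : Prop :=
  graph_connected (underlying_graph Q).

Definition X2_graph : 'M[nat]_2 := \matrix_(i, j) (if i == j then 0 else 2)%N.

Definition path_graph (m : nat) : 'M[nat]_m :=
  \matrix_(i, j) nat_of_bool ((i.+1 == j :> nat) || (j.+1 == i :> nat)).

Definition exchange_mx n (Q : cluster_quiver n) : 'M[int]_n :=
  \matrix_(i, j) ((arrows Q i j)%:Z - (arrows Q j i)%:Z).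

Definition mutation_mx n (k : 'I_n) (B : 'M[int]_n) : 'M[int]_n :=
  \matrix_(i, j)
    if (i == k) || (j == k) then - B i j
    else B i j + Num.sg (B i k) * Num.max (B i k * B k j) 0.

(* The quiver with exchange matrix B: b_ij arrows i -> j whenever b_ij > 0. *)
Definition arrows_of_mx n (B : 'M[int]_n) : 'M[nat]_n :=
  \matrix_(i, j) absz (Num.max (B i j) 0).

Lemma exchange_mx_skew n (Q : cluster_quiver n) i j :
  exchange_mx Q j i = - exchange_mx Q i j.
Proof. by rewrite !mxE opprB. Qed.

Lemma mutation_mx_skew n (k : 'I_n) (B : 'M[int]_n) :
  (forall i j, B j i = - B i j) ->
  forall i j, mutation_mx k B j i = - mutation_mx k B i j.
Proof.
move=> skewB i j; rewrite !mxE orbC; case: ifP => _; first by rewrite skewB.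
rewrite (skewB i j) (skewB k j) (skewB i k) mulrNN (mulrC (B k j)) opprD.
rewrite sgrN mulNr; congr (- _ - _).
set a := B i k; set b := B k j.
by case: (sgrP a) => ha; case: (sgrP b) => hb; nia.
Qed.

Fact arrows_of_mx_loop n (B : 'M[int]_n) :
  (forall i j, B j i = - B i j) -> forall i, arrows_of_mx B i i = 0%N.
Proof. by move=> skewB i; rewrite mxE; have := skewB i i; lia. Qed.

Fact arrows_of_mx_2cycle n (B : 'M[int]_n) :
  (forall i j, B j i = - B i j) ->
  forall i j, arrows_of_mx B i j = 0%N \/ arrows_of_mx B j i = 0%N.
Proof. by move=> skewB i j; rewrite !mxE; have := skewB i j; lia. Qed.

Definition quiver_of_mx n (B : 'M[int]_n)
    (skewB : forall i j, B j i = - B i j) : cluster_quiver n :=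
  ClusterQuiver (arrows_of_mx_loop skewB) (arrows_of_mx_2cycle skewB).

Lemma quiver_of_mxK n (B : 'M[int]_n) (skewB : forall i j, B j i = - B i j) :
  exchange_mx (quiver_of_mx skewB) = B.
Proof. by apply/matrixP=> i j; rewrite !mxE; have := skewB i j; lia. Qed.

Definition mutation n (Q : cluster_quiver n) (k : 'I_n) : cluster_quiver n :=
  quiver_of_mx (mutation_mx_skew k (exchange_mx_skew Q)).

Lemma exchange_mx_mutation n (Q : cluster_quiver n) k :
  exchange_mx (mutation Q k) = mutation_mx k (exchange_mx Q).
Proof. exact: quiver_of_mxK. Qed.

Definition quiver_iso m n (Q : cluster_quiver m) (Q' : cluster_quiver n) :=
  exists2 f : 'I_m -> 'I_n, bijective f &
    forall i j, arrows Q' (f i) (f j) = arrows Q i j.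

Definition mutation_equivalent m n
    (Q : cluster_quiver m) (Q' : cluster_quiver n) : Prop :=
  exists ks : seq 'I_m, quiver_iso (foldl (@mutation m) Q ks) Q'.

Definition eigenvalue_moduli (R : realType) n (Q : cluster_quiver n) : set R :=
  [set Normc.normc z | z in
     [set z : R[i] | eigenvalue (map_mx intr (exchange_mx Q)) z]].

Arguments eigenvalue_moduli R {n} Q.

(* A supremum over a finite set, hence a maximum when n > 0: see
   [exchange_spectrum_radius_attained] and [exchange_spectrum_radius_ge]. *)
Definition exchange_spectrum_radius (R : realType) n
    (Q : cluster_quiver n) : R :=
  sup (eigenvalue_moduli R Q).

Definition r_maximal (R : realType) (r : R) n (Q : cluster_quiver n) : Prop :=
  forall m (Q' : cluster_quiver m),
    mutation_equivalent Q Q' -> exchange_spectrum_radius R Q' <= r.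

Lemma eigenvalue_moduli_seq (R : realType) n (Q : cluster_quiver n) :
  exists s : seq R, eigenvalue_moduli R Q = [set x | x \in s].
Proof.
pose p := char_poly (map_mx intr (exchange_mx Q) : 'M[R[i]]_n).
have [zs Dp] := closed_field_poly_normal p.
have p_zs z : root p z = (z \in zs).
  rewrite Dp (monicP (char_poly_monic _)) scale1r.
  by rewrite root_prod_XsubC.
exists (map (@Normc.normc R) zs); apply/seteqP; split=> x /=.
  case=> z /=; rewrite eigenvalue_root_char -/p p_zs => zs_z <-.
  exact: map_f.
case/mapP=> z zs_z ->; exists z => //=.
by rewrite eigenvalue_root_char -/p p_zs.
Qed.

Lemma exchange_spectrum_radius_ge (R : realType) n (Q : cluster_quiver n)
    (z : R[i]) :
  eigenvalue (map_mx intr (exchange_mx Q)) z ->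
  Normc.normc z <= exchange_spectrum_radius R Q.
Proof.
move=> Qz; apply: ub_le_sup; last by exists z.
have [s ->] := eigenvalue_moduli_seq R Q.
elim: s => [|y s [b ub_b]]; first by exists 0.
exists (Num.max y b) => x /=; rewrite inE le_max.
by case/predU1P=> [->|/ub_b ->]; rewrite ?lexx ?orbT.
Qed.

Lemma exchange_spectrum_radius_attained (R : realType) n (Q : cluster_quiver n) :
  (0 < n)%N ->
  exists2 z : R[i], eigenvalue (map_mx intr (exchange_mx Q)) z &
    Normc.normc z = exchange_spectrum_radius R Q.
Proof.
move=> n_gt0.
have [z0 Qz0] : exists z0 : R[i], eigenvalue (map_mx intr (exchange_mx Q)) z0.
  have: size (char_poly (map_mx intr (exchange_mx Q) : 'M[R[i]]_n)) != 1%N.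
    by rewrite size_char_poly eqSS -lt0n.
  by case/closed_rootP=> z0 rz0; exists z0; rewrite eigenvalue_root_char.
suff: eigenvalue_moduli R Q (exchange_spectrum_radius R Q).
  by case=> z Qz <-; exists z.
have Q0 : eigenvalue_moduli R Q (Normc.normc z0) by exists z0.
rewrite /exchange_spectrum_radius; have [s Ds] := eigenvalue_moduli_seq R Q.
move: Q0; rewrite Ds /=; set x0 := Normc.normc z0 => sx0.
pose i0 : seq_sub s := SeqSub sx0.
pose M := [arg max_(i > i0) ssval i]%O.
have ubM x : x \in s -> x <= ssval M.
  rewrite /M; case: arg_maxP => //= i _ ub sx.
  exact: (ub (SeqSub sx)).
suff -> : sup [set x | x \in s] = ssval M by exact: ssvalP.
apply/eqP; rewrite eq_le; apply/andP; split.
  by apply: ge_sup; [exists x0 | move=> x; exact: ubM].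
apply: ub_le_sup; last exact: ssvalP.
by exists (ssval M) => x; exact: ubM.
Qed.

(* Main.v *)
Require Import Defs.
From mathcomp Require Import all_boot all_order all_algebra.
From mathcomp Require Import reals.
From mathcomp Require boolp classical_sets.
From mathcomp Require Import complex zify ring.

(** Why the theorem holds.

    The exchange matrix B is skew-symmetric, hence normal, so its spectral
    radius is its operator norm: the radius is at most 2 iff |xB| <= 2|x| for
    every complex row vector x ([stretch_le2], [spectral_radius_le2P]).  In
    this form the condition passes to full subquivers, because one may pad x
    with zeros; and since mutating at vertices of a full subquiver commutes
    with restricting to it, 2-maximality passes to full subquivers as well
    ([two_maximal_mxsub]).  It depends only on the mutation class
    ([two_maximal_equivalent]).

    If.  For the double arrow, mutation only changes the sign of B, and
    |xB| = 2|x|.  A path on at most four vertices is a full subquiver of a path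
    on exactly four, so A_4 suffices.  Its mutation class consists of quivers
    with p = 3 or 4 simple arrows, Pfaffian +1 or -1 and no acyclic triangle,
    conditions that are stable under mutation ([type_A4_closed]).  For a
    4-vertex quiver N = - B^2 is a root of N^2 - p N + Pf^2, so here
    N (p - N) = 1, and then p - N = (p - N) N (p - N) is positive
    semidefinite; this says |xB|^2 <= p |x|^2 <= 4 |x|^2
    ([quartic_stretch_le2]).

    Only if.  Unit vectors show that the squares of the entries in a row add up
    to at most 4.  Hence a multiple arrow is a double arrow isolated from all
    other vertices, so a connected quiver whose class contains one is X_2 up to
    mutation ([multiple_arrow]).  Otherwise all arrows in the class are
    simple, and one grows a full subquiver that is a linearly oriented path
    ([has_path_step]).  By connectedness some vertex v outside the path on k
    vertices is joined to it, by a column c of signs.  For k < 4, either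
    one can insert v in the path after at most one mutation at v, or a few
    mutations lead to a quiver that stretches some vector by more than 2; for
    k = 4 the latter always happens.  These are finitely many c, and the
    dichotomy is checked by evaluation ([extension_dichotomy]).  So the path
    grows until it covers all the vertices, of which there are at most four. *)

Set Implicit Arguments.
Unset Strict Implicit.
Unset Printing Implicit Defensive.

Import Order.TTheory GRing.Theory Num.Theory.

Local Open Scope ring_scope.

(** * Spectral radius and operator norm *)

Definition skew_symmetric n (B : 'M[int]_n) := forall i j, B j i = - B i j.

Section Stretch.
Local Open Scope sesquilinear_scope.
Variable C : numClosedFieldType.

Definition sqnorm n (x : 'rV[C]_n) : C := \sum_i `|x 0 i| ^+ 2.

Lemma sqnormE n (x : 'rV[C]_n) : sqnorm x = (x *m x ^t*) 0 0.
Proof. by rewrite mxE; apply: eq_bigr => i _; rewrite !mxE normCK. Qed.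

Lemma sqnorm_ge0 n (x : 'rV[C]_n) : 0 <= sqnorm x.
Proof. by apply: sumr_ge0 => i _; rewrite exprn_ge0. Qed.

Lemma sqnorm_gt0 n (x : 'rV[C]_n) : x != 0 -> 0 < sqnorm x.
Proof.
case/rV0Pn=> i nz_xi; rewrite /sqnorm (bigD1 i) //= ltr_wpDr ?exprn_gt0 ?normr_gt0 //.
by apply: sumr_ge0 => j _; rewrite exprn_ge0.
Qed.

Lemma sqnormZ n (a : C) (x : 'rV[C]_n) : sqnorm (a *: x) = `|a| ^+ 2 * sqnorm x.
Proof.
rewrite /sqnorm mulr_sumr; apply: eq_bigr => i _.
by rewrite mxE normrM exprMn.
Qed.

Lemma sqnorm_unitary m n (P : 'M[C]_(m, n)) (x : 'rV[C]_m) :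
  P \is unitarymx -> sqnorm (x *m P) = sqnorm x.
Proof.
move=> Pu; rewrite !sqnormE trmx_mul map_mxM mulmxA -(mulmxA x).
by rewrite (unitarymxP Pu) mulmx1.
Qed.

(** |xB| <= 2 |x|, squared. *)
Definition stretch_le2 n (B : 'M[int]_n) : Prop :=
  forall x : 'rV[C]_n, sqnorm (x *m map_mx intr B) <= 4 * sqnorm x.

Lemma stretch_le2_eigenvalue n (B : 'M[int]_n) (z : C) :
  stretch_le2 B -> eigenvalue (map_mx intr B) z -> `|z| <= 2.
Proof.
move=> bB /eigenvalueP[x xB /sqnorm_gt0 x_gt0]; have := bB x.
rewrite xB sqnormZ ler_pM2r // => z2.
by rewrite -(ler_pXn2r (n := 2)) ?nnegrE // -natrX.
Qed.

Lemma skew_adjoint n (B : 'M[int]_n) : skew_symmetric B ->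
  (map_mx intr B : 'M[C]_n) ^t* = - map_mx intr B.
Proof.
move=> skB; apply/matrixP => i j; rewrite !mxE skB.
by rewrite mulrNz rmorphN /= conj_Creal // realz.
Qed.

(** A skew-symmetric B is normal, so B = P^-1 D P with P unitary and D the
    diagonal of the eigenvalues: in the coordinates given by P, multiplication
    by B scales each coordinate by an eigenvalue. *)
Lemma eigenvalue_stretch_le2 n (B : 'M[int]_n) : skew_symmetric B ->
  (forall z : C, eigenvalue (map_mx intr B) z -> `|z| <= 2) -> stretch_le2 B.
Proof.
move=> skB evB x; set M := map_mx intr B.
have /orthomx_spectralP DM : M \is normalmx.
  by apply/normalmxP; rewrite /M skew_adjoint // mulmxN mulNmx.
have Pu := spectral_unitarymx M; have Punit := spectral_unit M.
set P := spectralmx M in DM Pu Punit; set d := spectral_diag M in DM.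
have PM : P *m M = diag_mx d *m P by rewrite {1}DM !mulmxA mulmxV // mul1mx.
have evd i : `|d 0 i| <= 2.
  apply: evB; apply/eigenvalueP; exists (row i P).
    by rewrite -row_mul PM row_mul row_diag_mx -scalemxAl -rowE.
  rewrite -row_free_unit in Punit; apply: contraTneq Punit => Pi0.
  by apply/row_freePn; exists i; rewrite Pi0 sub0mx.
have -> : x = x *m invmx P *m P by rewrite mulmxKV.
move: (x *m _) => y; rewrite -mulmxA PM mulmxA.
rewrite (sqnorm_unitary _ Pu) (sqnorm_unitary y Pu).
rewrite mulr_sumr; apply: ler_sum => i _.
rewrite mul_mx_diag mxE normrM exprMn mulrC ler_wpM2r ?exprn_ge0 //.
by rewrite -[4]/(2 * 2)%:R natrM -expr2 lerXn2r ?nnegrE.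
Qed.

(** With S the 0-1 matrix of f, the submatrix is S B S^T; multiplying a row by
    S pads it with zeros, multiplying it by S^T drops entries. *)
Lemma stretch_le2_mxsub m n (f : 'I_m -> 'I_n) (B : 'M[int]_n) :
  injective f -> stretch_le2 B -> stretch_le2 (mxsub f f B).
Proof.
move=> injf bB x; pose S : 'M[C]_(m, n) := rowsub f 1%:M.
have SE i j : S i j = (f i == j)%:R by rewrite !mxE.
have Su : S \is unitarymx.
  apply/unitarymxP/matrixP=> i j; rewrite mxE (bigD1 (f i)) //= big1 => [|k].
    by rewrite !mxE eqxx mul1r addr0 (inj_eq injf) conjC_nat eq_sym.
  by rewrite SE eq_sym => /negPf->; rewrite mul0r.
have ES (w : 'rV[C]_n) i : (w *m S^T) 0 i = w 0 (f i).
  rewrite mxE (bigD1 (f i)) //= big1 => [|k]; rewrite mxE SE.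
    by rewrite eqxx mulr1 addr0.
  by rewrite eq_sym => /negPf->; rewrite mulr0.
have -> : map_mx intr (mxsub f f B) = S *m map_mx intr B *m S^T.
  by apply/row_matrixP=> k; apply/rowP=> i;
     rewrite row_mul mxE ES /S mul_rowsub_mx mul1mx !mxE.
rewrite !mulmxA -(sqnorm_unitary x Su); apply: le_trans (bB _).
move: (x *m S *m _) => w; rewrite /sqnorm.
under eq_bigr do rewrite ES.
rewrite -(big_imset (fun j => `|w 0 j| ^+ 2)) /=; last by move=> i j _ _ /injf.
rewrite [leRHS](bigID (fun j => j \in f @: 'I_m)) /= lerDl.
by apply: sumr_ge0 => j _; rewrite exprn_ge0.
Qed.

Lemma stretch_le2_int n (B : 'M[int]_n) (x : 'I_n -> int) : stretch_le2 B ->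
  \sum_j (\sum_i x i * B i j) ^+ 2 <= 4 * \sum_i x i ^+ 2.
Proof.
move=> /(_ (\row_i (x i)%:~R)) bx; rewrite -(ler_int C).
rewrite rmorphM /= !rmorph_sum /=; apply: le_trans (le_trans bx _).
  apply: ler_sum => j _; rewrite mxE.
  rewrite [leRHS](_ : _ = `|(\sum_i x i * B i j)%:~R : C| ^+ 2).
    by rewrite rmorphXn /= real_normK ?realz.
  by rewrite rmorph_sum; congr (`| _ | ^+ 2); apply: eq_bigr => i _; rewrite !mxE rmorphM.
rewrite ler_wpM2l // ler_sum // => i _.
by rewrite mxE rmorphXn /= real_normK ?realz.
Qed.
End Stretch.

(** * Mutation classes and full subquivers *)

Definition mutations n (B : 'M[int]_n) (ks : seq 'I_n) : 'M[int]_n :=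
  foldl (fun B k => mutation_mx k B) B ks.

Lemma mutations_cat n (B : 'M[int]_n) ks1 ks2 :
  mutations B (ks1 ++ ks2) = mutations (mutations B ks1) ks2.
Proof. exact: foldl_cat. Qed.

(** Mutation at k negates the row and the column of k, so the second mutation
    subtracts the correction that the first one added. *)
Lemma mutation_mxK n (k : 'I_n) : involutive (@mutation_mx n k).
Proof.
move=> B; apply/matrixP=> i j; rewrite !mxE eqxx orbT /=.
case: (_ || _); first by rewrite opprK.
by rewrite mulrNN sgrN mulNr addrK.
Qed.

Lemma mutationsK n (B : 'M[int]_n) ks : mutations (mutations B ks) (rev ks) = B.
Proof.
elim: ks B => //= k ks IHks B.
by rewrite rev_cons -cats1 mutations_cat IHks /= mutation_mxK.
Qed.

Lemma mutation_skew n (k : 'I_n) (B : 'M[int]_n) :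
  skew_symmetric B -> skew_symmetric (mutation_mx k B).
Proof. exact: mutation_mx_skew. Qed.

Lemma mutations_skew n (B : 'M[int]_n) ks :
  skew_symmetric B -> skew_symmetric (mutations B ks).
Proof. by elim: ks B => //= k ks IHks B skB; apply/IHks/mutation_skew. Qed.

Lemma mutations_mxsub m n (f : 'I_m -> 'I_n) (B : 'M[int]_n) ks :
  injective f ->
  mutations (mxsub f f B) ks = mxsub f f (mutations B (map f ks)).
Proof.
move=> injf; elim: ks B => //= k ks IHks B; rewrite -IHks; congr mutations.
by apply/matrixP=> i j; rewrite !mxE !(inj_eq injf).
Qed.

Lemma exchange_mx_mutations n (Q : cluster_quiver n) ks :
  exchange_mx (foldl (@mutation n) Q ks) = mutations (exchange_mx Q) ks.
Proof. by elim: ks Q => //= k ks IHks Q; rewrite IHks exchange_mx_mutation. Qed.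

Lemma exchange_mxK n (Q : cluster_quiver n) : arrows_of_mx (exchange_mx Q) = arrows Q.
Proof. by apply/matrixP=> i j; rewrite !mxE; have := no_2cycle Q i j; lia. Qed.

Lemma quiver_isoP m n (Q : cluster_quiver m) (Q' : cluster_quiver n) :
  quiver_iso Q Q' <->
  exists2 f : 'I_m -> 'I_n, bijective f & mxsub f f (exchange_mx Q') = exchange_mx Q.
Proof.
split=> -[f bijf eqf]; exists f => //.
  by apply/matrixP=> i j; rewrite !mxE !eqf.
by move=> i j; rewrite -!exchange_mxK -eqf !mxE.
Qed.

Section TwoMaximal.
Variable C : numClosedFieldType.

(** 2-maximality of the exchange matrix: see [r_maximal_mxP]. *)
Definition two_maximal n (B : 'M[int]_n) := forall ks, stretch_le2 C (mutations B ks).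

Lemma two_maximal_mutations n (B : 'M[int]_n) ks :
  two_maximal B -> two_maximal (mutations B ks).
Proof. by move=> mB ks'; rewrite -mutations_cat. Qed.

Lemma two_maximal_mxsub m n (f : 'I_m -> 'I_n) (B : 'M[int]_n) :
  injective f -> two_maximal B -> two_maximal (mxsub f f B).
Proof. by move=> injf mB ks; rewrite mutations_mxsub //; apply: stretch_le2_mxsub. Qed.

Lemma two_maximal_equivalent m n (Q : cluster_quiver m) (Q' : cluster_quiver n) :
  mutation_equivalent Q Q' -> two_maximal (exchange_mx Q') -> two_maximal (exchange_mx Q).
Proof.
case=> ks /quiver_isoP[f /bij_inj injf]; rewrite exchange_mx_mutations => eqf mQ'.
rewrite -(mutationsK (exchange_mx Q) ks) -eqf.
by apply: two_maximal_mutations; apply: two_maximal_mxsub.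
Qed.
End TwoMaximal.

Lemma spectral_radius_le2P (R : realType) n (Q : cluster_quiver n) :
  exchange_spectrum_radius R Q <= 2 <-> stretch_le2 R[i] (exchange_mx Q).
Proof.
split=> [rQ | bQ].
  apply: eigenvalue_stretch_le2 => [i j | z Qz]; first exact: exchange_mx_skew.
  have := le_trans (exchange_spectrum_radius_ge Qz) rQ.
  by rewrite -lecR rmorph_nat.
case: n Q bQ => [|n] Q bQ.
  (* Without vertices the radius is the supremum of the empty set, which is 0. *)
  have spec0 : eigenvalue_moduli R Q = classical_sets.set0.
    apply/classical_sets.seteqP; split=> // x [z /= /eigenvalueP[v _ /eqP[]]].
    by apply/rowP=> -[].
  by rewrite /exchange_spectrum_radius spec0 sup0.
have [z Qz <-] := exchange_spectrum_radius_attained R Q (ltn0Sn n).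
by have := stretch_le2_eigenvalue bQ Qz; rewrite -lecR rmorph_nat.
Qed.

Lemma r_maximal_mxP (R : realType) n (Q : cluster_quiver n) :
  r_maximal (2 : R) Q <-> two_maximal R[i] (exchange_mx Q).
Proof.
split=> [mQ ks | mQ m Q' QQ'].
  rewrite -exchange_mx_mutations; apply/spectral_radius_le2P/mQ.
  by exists ks; exists id => //; exists id.
apply/spectral_radius_le2P; case: QQ' => ks /quiver_isoP[f [g fK gK]].
rewrite exchange_mx_mutations => eqf.
suff -> : exchange_mx Q' = mxsub g g (mutations (exchange_mx Q) ks).
  by apply: stretch_le2_mxsub (mQ ks); apply: can_inj gK.
by rewrite -eqf; apply/matrixP=> i j; rewrite !mxE !gK.
Qed.

(** * Evaluating mutations of explicit matrices *)

(** Matrices given by functions on all natural numbers, and mutation of such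
    functions: unlike matrix expressions, these evaluate. *)
Definition fun_mx n (b : nat -> nat -> int) : 'M[int]_n := \matrix_(i, j) b i j.

Definition mutation_fun (k : nat) (b : nat -> nat -> int) (i j : nat) : int :=
  if (i == k) || (j == k) then - b i j
  else b i j + Num.sg (b i k) * Num.max (b i k * b k j) 0.

Lemma mutation_fun_mx n (k : 'I_n) b :
  mutation_mx k (fun_mx n b) = fun_mx n (mutation_fun k b).
Proof. by apply/matrixP=> i j; rewrite !mxE. Qed.

Fixpoint sign_words (k : nat) : seq (seq int) :=
  if k is k'.+1 then [seq a :: s | a <- [:: 0; 1; -1], s <- sign_words k']
  else [:: [::]].

Lemma mem_sign_words k (s : seq int) :
  (s \in sign_words k) = (size s == k) && all (mem [:: 0; 1; -1]) s.
Proof.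
elim: k s => [|k IHk] [|a s] //; first by apply/allpairsP => -[[? ?] []].
rewrite [all _ _]/= andbCA eqSS -IHk; apply/allpairsP/andP.
  by case=> -[b t] [/= ? ?] [-> ->].
by case=> ? ?; exists (a, s).
Qed.

(** * The mutation class of A_4 *)

Definition pairs4 := [seq (i, j) | i <- iota 0 4, j <- iota i.+1 (3 - i)].

(** The skew-symmetric 4 x 4 matrix with the list s above the diagonal.  A pair
    that is not in [pairs4] has index 6, where [nth] returns 0. *)
Definition skew4 (s : seq int) (i j : nat) : int :=
  nth 0 s (index (i, j) pairs4) - nth 0 s (index (j, i) pairs4).

Definition upper4 (b : nat -> nat -> int) : seq int := [seq b p.1 p.2 | p <- pairs4].

Definition upper4_mx (B : 'M[int]_4) : seq int :=
  upper4 (fun i j => B (inord i) (inord j)).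

Lemma upper4_fun_mx b : upper4_mx (fun_mx 4 b) = upper4 b.
Proof. by rewrite /upper4_mx /upper4 /= !mxE !inordK. Qed.

Lemma skew4_upper4 B : skew_symmetric B -> fun_mx 4 (skew4 (upper4_mx B)) = B.
Proof.
move=> skB; have B0 i : B i i = 0 by have := skB i i; lia.
apply/matrixP=> i j; rewrite mxE /skew4 /upper4_mx.
rewrite -[i in RHS]inord_val -[j in RHS]inord_val.
case: i j => [[|[|[|[|//]]]] ?] [[|[|[|[|//]]]] ?] /=;
  by rewrite ?B0 ?subr0 // sub0r -skB.
Qed.

(** The Pfaffian of [skew4 s]: its square is the determinant. *)
Definition pf4 (s : seq int) : int := s`_0 * s`_5 - s`_1 * s`_4 + s`_2 * s`_3.

(** For x = b_ij, y = b_jk and z = b_ki, all in {0, 1, -1}: if the three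
    vertices form a triangle, it is an oriented cycle. *)
Definition cyclic_triangle (x y z : int) := (x * y * z == 0) || (x == y) && (y == z).

(** The quivers with three or four arrows, all simple, no acyclic triangle and
    Pfaffian +1 or -1.  The Pfaffian excludes the star, the 4-cycles and a
    triangle with an isolated vertex; a lower bound on the number of arrows
    excludes two disjoint arrows.  What remains are the paths and the oriented
    triangles with a pendant arrow. *)
Definition type_A4 (s : seq int) : bool :=
  [&& all (mem [:: 0; 1; -1]) s, count (predC1 0) s \in [:: 3; 4]%N,
      pf4 s ^+ 2 == 1,
      cyclic_triangle s`_0 s`_3 (- s`_1), cyclic_triangle s`_0 s`_4 (- s`_2),
      cyclic_triangle s`_1 s`_5 (- s`_2) & cyclic_triangle s`_3 s`_5 (- s`_4)].

Lemma type_A4_closed :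
  all (fun s => type_A4 s ==>
    all (fun k => type_A4 (upper4 (mutation_fun k (skew4 s)))) (iota 0 4))
  (sign_words 6).
Proof. by vm_compute. Qed.

Lemma type_A4_mutations B ks : skew_symmetric B ->
  type_A4 (upper4_mx B) -> type_A4 (upper4_mx (mutations B ks)).
Proof.
elim: ks B => //= k ks IHks B skB tB; apply: IHks; first exact: mutation_skew.
have /allP/(_ (upper4_mx B)) := type_A4_closed.
rewrite mem_sign_words tB; have /andP[-> _] := tB => /(_ isT)/allP/(_ (val k)).
by rewrite mem_iota ltn_ord -upper4_fun_mx -mutation_fun_mx skew4_upper4 //; apply.
Qed.

(** The Cayley-Hamilton theorem for skew-symmetric 4 x 4 matrices, whose
    characteristic polynomial is X^4 + p X^2 + Pf^2 with p the sum of the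
    squares of the entries above the diagonal. *)
Lemma skew4_identity (s : seq int) (B := fun_mx 4 (skew4 s)) : size s = 6%N ->
  B *m B *m (B *m B + (\sum_(x <- s) x ^+ 2)%:M) = - (pf4 s ^+ 2)%:M.
Proof.
rewrite {}/B; case: s => [|a [|b [|c [|d [|e [|f [|]]]]]]] //= _.
set p := \sum_(x <- _) _.
have -> : p = a ^+ 2 + b ^+ 2 + c ^+ 2 + d ^+ 2 + e ^+ 2 + f ^+ 2.
  by rewrite /p !big_cons big_nil addr0 !addrA.
rewrite {p} /pf4 /=; apply/matrixP=> i j.
rewrite mxE !big_ord_recl big_ord0 !mxE !big_ord_recl !big_ord0 !mxE.
case: i j => [[|[|[|[|//]]]] ?] [[|[|[|[|//]]]] ?];
 rewrite /skew4 /bump /=; ring.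
Qed.

Section TwoMaximalExamples.
Local Open Scope sesquilinear_scope.
Variable C : numClosedFieldType.

(** A = B^2 + p is Hermitian and B^2 A = -1, so A = - A B^2 A = (A B)(A B)^*.
    Therefore p |x|^2 - |xB|^2 = x A x^* = |xAB|^2 >= 0. *)
Lemma quartic_stretch_le2 n (B : 'M[int]_n) (p : int) : skew_symmetric B -> p <= 4 ->
  B *m B *m (B *m B + p%:M) = - 1%:M -> stretch_le2 C B.
Proof.
move=> skB p4 eqB x; set M := map_mx intr B; pose A := M *m M + p%:~R%:M.
have adjM : M ^t* = - M by exact: skew_adjoint.
have eqM : M *m M *m A = - 1%:M.
  have := congr1 (map_mx (intr : int -> C)) eqB.
  by rewrite !(map_mxM, map_mxD, map_mxN) /= map_scalar_mx /= map_mx1.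
have adjA : A ^t* = A.
  rewrite linearD /= map_mxD /= trmx_mul map_mxM /= adjM mulNmx mulmxN opprK.
  by rewrite tr_scalar_mx map_scalar_mx /= conj_Creal // realz.
have sqM (y : 'rV_n) : sqnorm (y *m M) = - (y *m M *m M *m y ^t*) 0 0.
  rewrite sqnormE trmx_mul map_mxM /= adjM mulNmx mulmxN !mulmxA.
  by rewrite [in LHS]mxE.
have sqA : p%:~R * sqnorm x = sqnorm (x *m M) + sqnorm (x *m A *m M).
  rewrite !sqM trmx_mul map_mxM /= adjA !mulmxA.
  rewrite -(mulmxA (x *m A) M M) -(mulmxA (x *m A) (M *m M) A) eqM.
  rewrite mulmxN mulmx1 mulNmx [X in _ - X]mxE opprK /A mulmxDr mulmxDl.
  by rewrite mul_mx_scalar -scalemxAl !mulmxA [X in _ + X]mxE addKr mxE sqnormE.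
apply: (@le_trans _ _ (p%:~R * sqnorm x)).
  by rewrite sqA lerDl sqnorm_ge0.
by rewrite ler_wpM2r ?sqnorm_ge0 // -[4]/(4%:~R) ler_int.
Qed.

Lemma type_A4_two_maximal (B : 'M[int]_4) :
  skew_symmetric B -> type_A4 (upper4_mx B) -> two_maximal C B.
Proof.
move=> skB tB ks; have := type_A4_mutations ks skB tB.
have := mutations_skew ks skB; move: (mutations B ks) => {B skB tB ks} B skB.
case/and4P=> Ds ps /eqP pf _.
apply: (@quartic_stretch_le2 _ _ (count (predC1 0) (upper4_mx B))) => //.
  by move: ps; rewrite !inE => /orP[]/eqP->.
have := @skew4_identity (upper4_mx B) erefl; rewrite pf skew4_upper4 // => <-.
congr (_ *m (_ + _%:M)); rewrite -natz -sum1_count natr_sum big_mkcond /=.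
rewrite [LHS]big_seq [RHS]big_seq.
by apply: eq_bigr => x /(allP Ds); rewrite !inE => /or3P[]/eqP->.
Qed.

(** On two vertices every mutation is a change of sign of B. *)
Lemma double_arrow_two_maximal (B : 'M[int]_2) :
  skew_symmetric B -> `|B 0 1| = 2 -> two_maximal C B.
Proof.
move=> skB B01 ks.
have {B01}: `|mutations B ks 0 1| = 2.
  elim: ks B {skB} B01 => //= k ks IHks B B01; apply: IHks.
  rewrite mxE ifT ?normrN //.
  by case: k => [[|[|//]]] lt_k.
have := mutations_skew ks skB; move: (mutations B ks) => {B skB ks} B skB B01 x.
have Bii i : B i i = 0 by have := skB i i; lia.
have normB : `|(B 0 1)%:~R : C| = 2 by rewrite -intr_norm B01.
rewrite /sqnorm !big_ord_recl !big_ord0 !mxE !big_ord_recl !big_ord0 !mxE.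
rewrite (_ : lift _ _ = 1); last exact/val_inj.
rewrite !Bii (skB 0 1) !mulr0 add0r !addr0 mulrNz mulrN normrN !normrM normB.
by rewrite !exprMn -natrX -mulrDl mulrC addrC.
Qed.
End TwoMaximalExamples.

Definition linear_fun (i j : nat) : int := (i.+1 == j)%:Z - (j.+1 == i)%:Z.

Lemma orientation_entry n (G : 'M[nat]_n) (Q : cluster_quiver n) i j :
  is_orientation G Q -> `|exchange_mx Q i j| = (G i j)%:Z.
Proof. by move=> <-; rewrite !mxE; have := no_2cycle Q i j; lia. Qed.

Lemma path_two_maximal (C : numClosedFieldType) m (Q : cluster_quiver m) :
  (1 <= m <= 4)%N -> is_orientation (path_graph m) Q -> two_maximal C (exchange_mx Q).
Proof.
case: m Q => // m Q m4 Qpath; set B := exchange_mx Q.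
have skB : skew_symmetric B by exact: exchange_mx_skew.
have absB i j : `|B i j| = ((i.+1 == j :> nat) || (j.+1 == i :> nat))%:Z.
  by rewrite (orientation_entry _ _ Qpath) mxE.
(* Extend the path to four vertices by arrows i -> i+1. *)
pose b i j := if (i <= m)%N && (j <= m)%N then B (inord i) (inord j) else linear_fun i j.
have skb : skew_symmetric (fun_mx 4 b).
  move=> i j; rewrite !mxE /b andbC; case: ifP => _; first exact: skB.
  by rewrite opprB.
have absb i j : `|b i j| = ((i.+1 == j) || (j.+1 == i))%:Z.
  rewrite /b; case: ifP => [/andP[im jm] | _]; first by rewrite absB !inordK.
  rewrite /linear_fun; lia.
have -> : B = mxsub (widen_ord m4) (widen_ord m4) (fun_mx 4 b).
  by apply/matrixP=> i j; rewrite !mxE /b /= !leq_ord !inord_val !mxE.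
apply: two_maximal_mxsub => [i j /(congr1 val)/= /val_inj // |].
apply: type_A4_two_maximal => //; rewrite upper4_fun_mx /upper4 /=.
have zero i j : `|b i j| = 0 -> b i j = 0 by move/normr0_eq0.
rewrite (zero 0 2)%N ?absb // (zero 0 3)%N ?absb // (zero 1 3)%N ?absb //.
have sign i j : `|b i j| = 1 -> b i j \in [:: 1; -1].
  rewrite !inE; lia.
have := (sign 0 1 (absb _ _), sign 1 2 (absb _ _), sign 2 3 (absb _ _))%N.
rewrite !inE => -[[/orP[]/eqP-> /orP[]/eqP->] /orP[]/eqP->]; by vm_compute.
Qed.

(** * Connectedness *)

(** No arrow joins S to its complement.  Connectedness in terms of cuts is easy
    to carry through a mutation: any arrow that a mutation creates comes from
    a path of length 2 through the mutated vertex. *)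
Definition cut n (B : 'M[int]_n) (S : {set 'I_n}) :=
  [forall i in S, forall j in ~: S, B i j == 0].

Lemma cutP n (B : 'M[int]_n) (S : {set 'I_n}) :
  reflect {in S & ~: S, forall i j, B i j = 0} (cut B S).
Proof.
apply: (iffP forall_inP) => [cutS i j iS jS | cutS i iS].
  by apply/eqP; have /forall_inP := cutS i iS; apply.
by apply/forall_inP => j jS; rewrite cutS.
Qed.

Definition indecomposable n (B : 'M[int]_n) :=
  forall S, cut B S -> S = set0 \/ S = [set: 'I_n].

Lemma cut_mutation n (B : 'M[int]_n) k S : cut B S -> cut (mutation_mx k B) S.
Proof.
move/cutP=> B0; apply/cutP=> i j iS jS; rewrite mxE B0 // oppr0 add0r.
case: ifP => // _; have [kS | kS] := boolP (k \in S).
  by rewrite (B0 k j) // mulr0 maxxx mulr0.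
by rewrite (B0 i k) ?inE // sgr0 mul0r.
Qed.

Lemma indecomposable_mutations n (B : 'M[int]_n) ks :
  indecomposable B -> indecomposable (mutations B ks).
Proof.
elim: ks B => //= k ks IHks B indB; apply: IHks => S cutS; apply: indB.
by rewrite -(mutation_mxK k B); apply: cut_mutation.
Qed.

Lemma connected_indecomposable n (Q : cluster_quiver n) :
  quiver_connected Q -> indecomposable (exchange_mx Q).
Proof.
case=> _ connQ S /cutP cutS.
have clS : closed (fun k l => 0 < underlying_graph Q k l)%N S.
  move=> i j; rewrite mxE => Gij; apply/idP/idP => [iS | jS]; apply: contraTT Gij.
    by move=> jS; have := cutS i j; rewrite !inE !mxE => /(_ iS jS);
       have := no_2cycle Q i j; lia.
  by move=> iS; have := cutS j i; rewrite !inE !mxE => /(_ jS iS);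
     have := no_2cycle Q i j; lia.
have [-> | [i iS]] := set_0Vmem S; [by left | right].
by apply/setP=> j; rewrite inE -(closed_connect clS (connQ i j)).
Qed.

(** * Growing a linearly oriented path *)

Section Growth.
Variable C : numClosedFieldType.

(** The inequality for the unit vector at i. *)
Lemma row_sqnorm_le n (B : 'M[int]_n) i : stretch_le2 C B -> \sum_j B i j ^+ 2 <= 4.
Proof.
move=> bB; pose x (l : 'I_n) : int := (l == i)%:Z.
have sum_x (F : 'I_n -> int) : \sum_l x l * F l = F i.
  rewrite (bigD1 i) //= big1 ?addr0 => [|l /negPf li]; first by rewrite /x eqxx mul1r.
  by rewrite /x li mul0r.
have := stretch_le2_int x bB; under eq_bigr do rewrite sum_x.
by rewrite (sum_x x) /x eqxx.
Qed.

Lemma two_entries_sqr_le n (B : 'M[int]_n) i j l :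
  stretch_le2 C B -> l != j -> B i j ^+ 2 + B i l ^+ 2 <= 4.
Proof.
move=> /(row_sqnorm_le i); rewrite (bigD1 j) //= => row_le lj.
rewrite (bigD1 l) //= in row_le; apply: le_trans row_le.
by rewrite lerD2l lerDl sumr_ge0 // => *; rewrite sqr_ge0.
Qed.

(** A double arrow uses up the bound 4 on the rows of both of its ends, so the
    two ends form a cut. *)
Lemma multiple_arrow n (B : 'M[int]_n) i j :
  skew_symmetric B -> indecomposable B -> stretch_le2 C B -> 1 < `|B i j| ->
  n = 2%N /\ forall k l, k != l -> `|B k l| = 2.
Proof.
move=> skB indB bB Bij.
have nij : i != j by apply: contraTneq Bij => ->; have := skB j j; lia.
have row0 k l m : 1 < `|B k l| -> m != l -> B k m = 0.
  by move=> Bkl /(two_entries_sqr_le k bB); nia.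
have Bji : 1 < `|B j i| by rewrite skB normrN.
have cut_ij : cut B [set i; j].
  apply/cutP=> k l; rewrite !inE negb_or => /orP[]/eqP-> /andP[li lj].
    by rewrite (row0 _ j).
  by rewrite (row0 _ i).
have [/setP/(_ i) | Eij] := indB _ cut_ij; first by rewrite !inE eqxx.
have Bij2 : `|B i j| = 2.
  have := row_sqnorm_le i bB; rewrite (bigD1 j) //= => row_le.
  suff : B i j ^+ 2 <= 4 by nia.
  by apply: le_trans row_le; rewrite lerDl sumr_ge0 // => *; rewrite sqr_ge0.
split; first by rewrite -[n]card_ord -cardsT -Eij cards2 nij.
move=> k l; have := in_setT k; have := in_setT l; rewrite -Eij !inE.
by case/orP=> /eqP-> /orP[]/eqP->; rewrite ?eqxx // skB normrN.
Qed.

Definition has_path n (B : 'M[int]_n) k :=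
  exists ks (f : 'I_k -> 'I_n),
    injective f /\ mxsub f f (mutations B ks) = fun_mx k linear_fun.

Definition mutations_fun := foldl (fun b k => mutation_fun k b).

Lemma mutations_fun_mx n b (w : seq nat) : all (fun a => a <= n)%N w ->
  mutations (fun_mx n.+1 b) (map inord w) = fun_mx n.+1 (mutations_fun b w).
Proof.
elim: w b => //= a w IHw b /andP[an wn]; rewrite -IHw // mutation_fun_mx.
by rewrite inordK.
Qed.

(** The path 0 -> 1 -> ... -> k-1 together with a vertex k such that b_ik is the
    i-th entry of c.  Entry (k, k) is minus the k-th entry of c, that is 0 when
    c has size k. *)
Definition extension_fun k (c : seq int) (i j : nat) : int :=
  if i == k then - c`_j else if j == k then c`_i else linear_fun i j.

(** The list 0, ..., k-1 with k inserted in position q. *)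
Definition insertion k q i := if (i < q)%N then i else if i == q then k else i.-1.

Definition reduces k c (w : seq nat) (q : nat) :=
  all (fun i => all (fun j =>
    mutations_fun (extension_fun k c) w (insertion k q i) (insertion k q j) ==
      linear_fun i j) (iota 0 k.+1)) (iota 0 k.+1).

(** An iterated sum that evaluates. *)
Definition sum_fun n (F : nat -> int) := foldr (fun i s => F i + s) 0 (iota 0 n).

Lemma sum_funE n F : sum_fun n F = \sum_(i < n) F i.
Proof. by rewrite -(big_mkord xpredT) unlock /index_iota subn0. Qed.

Definition overstretches n (b : nat -> nat -> int) (x : seq int) :=
  4 * sum_fun n (fun i => x`_i ^+ 2) <
    sum_fun n (fun j => sum_fun n (fun i => x`_i * b i j) ^+ 2).

Lemma overstretchesP n b x : overstretches n b x -> ~ stretch_le2 C (fun_mx n b).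
Proof.
rewrite /overstretches !sum_funE => bx /(stretch_le2_int (fun i : 'I_n => x`_i)).
rewrite leNgt; case/negP; congr (_ < _): bx; apply: eq_bigr => j _.
by rewrite sum_funE; congr (_ ^+ 2); apply: eq_bigr => i _; rewrite mxE.
Qed.

(** Each pair is a sequence of mutations and a vector that the resulting matrix
    stretches by more than 2, for at least one of the extensions of the
    path on k vertices.  For k = 2 these deal with the acyclic triangles, where
    mutation creates a double arrow next to a simple one.  For k = 3 they deal
    with the star D_4, the 4-cycles, which mutate to two triangles with a common
    arrow, and the quivers with an acyclic triangle.  For k = 4 they deal with all
    extensions; those of type A_5, for instance, mutate to two triangles with a
    common vertex, which have the eigenvalue i sqrt 5. *)
Definition obstructions k : seq (seq nat * seq int) :=
  match k with
  | 2 => [:: ([:: 0; 1]%N, [:: 0; 0; 1]); ([:: 1]%N, [:: 0; 0; 1])]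
  | 3 => [:: ([:: 1]%N, [:: 1; -1; 1; 1]); ([:: 3]%N, [:: 1; -1; 1; -1]);
             ([:: 0; 1]%N, [:: 0; 0; 0; 1]); ([:: 1; 2]%N, [:: 0; 0; 0; 1])]
  | 4 => [:: ([:: 4; 1; 2]%N, [:: 1; -1; 1; -1; -1]);
             ([:: 1; 3; 2]%N, [:: 1; -1; -1; 1; 0]);
             ([:: 0; 2]%N, [:: 0; 1; -1; 1; -1]);
             ([:: 1]%N, [:: 0; 1; -1; 1; 0]);
             ([:: 2]%N, [:: 0; 1; 0; -1; -1]);
             ([:: 1; 4; 3]%N, [:: 0; 1; -1; 0; 1]);
             ([:: 2; 4; 0]%N, [:: 0; 1; -1; 0; -1])]
  | _ => [::]
  end.

Definition obstructed k c (wx : seq nat * seq int) :=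
  all (fun a => a <= k)%N wx.1 &&
  overstretches k.+1 (mutations_fun (extension_fun k c) wx.1) wx.2.

(** For k = 1, 2, 3 an extension of type A_(k+1) needs at most one mutation, at
    the new vertex: this reverses the arrow that joins it to an end of the path,
    or opens the oriented triangle that it forms with two consecutive vertices. *)
Lemma extension_dichotomy :
  all (fun k => all (fun c =>
    [|| all (pred1 0) c,
        (k < 4)%N && has (fun w => has (reduces k c w) (iota 0 k.+1)) [:: [::]; [:: k]]
      | has (obstructed k c) (obstructions k)]) (sign_words k)) (iota 1 4).
Proof. by vm_compute. Qed.

Lemma extension_path k (c : seq int) : (1 <= k <= 4)%N -> c \in sign_words k ->
  ~~ all (pred1 0) c -> two_maximal C (fun_mx k.+1 (extension_fun k c)) ->
  (k < 4)%N /\ has_path (fun_mx k.+1 (extension_fun k c)) k.+1.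
Proof.
move=> /andP[k1 k4] Dc /negPf c0 mE.
have /allP/(_ k) := extension_dichotomy.
rewrite mem_iota add1n ltnS k1 k4 => /(_ isT)/allP/(_ c Dc).
rewrite c0 orFb; case/orP; last first.
  case/hasP=> -[w x] _ /andP[kw bx].
  by case: (overstretchesP bx); rewrite -mutations_fun_mx.
case/andP=> k3 /hasP[w kw /hasP[q qk red]].
split=> //; exists (map inord w), (fun i => inord (insertion k q i)).
have ins i : (i <= k)%N -> (insertion k q i <= k)%N.
  by rewrite /insertion; case: ifP => // _; case: ifP; lia.
split=> [i j /(congr1 val) | ].
  rewrite /= !inordK ?ltnS ?ins ?leq_ord // => eq_ij; apply/val_inj; move: eq_ij.
  move: (leq_ord i) (leq_ord j) => /=; rewrite mem_iota in qk.
  by rewrite /insertion; do !case: ifP; lia.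
rewrite mutations_fun_mx; last first.
  by move: kw; rewrite !inE => /orP[]/eqP->; rewrite //= leqnn.
apply/matrixP=> i j; rewrite !mxE !inordK ?ltnS ?ins ?leq_ord //.
have /allP/(_ (val i)) := red; rewrite mem_iota ltn_ord => /(_ isT).
by move/allP/(_ (val j)); rewrite mem_iota ltn_ord => /(_ isT)/eqP.
Qed.

(** Connectedness gives a vertex v joined to the path.  Since all arrows are
    simple, the full subquiver on the path and v is one of the finitely many
    extensions of [extension_path], and mutations of this subquiver are
    mutations of the whole quiver. *)
Lemma has_path_step n (B : 'M[int]_n) k : skew_symmetric B -> indecomposable B ->
  two_maximal C B -> (forall ks i j, `|mutations B ks i j| <= 1) ->
  (1 <= k <= 4)%N -> (k < n)%N -> has_path B k -> (k < 4)%N /\ has_path B k.+1.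
Proof.
move=> skB indB mB B1 k14 kn [ks [f [injf Bf]]].
have := mutations_skew ks skB; have := indecomposable_mutations (ks := ks) indB.
have {B1} := B1 ks; have := two_maximal_mutations ks mB.
set B' := mutations B ks in Bf * => mB' B'1 indB' skB'.
have cardS : #|f @: 'I_k| = k by rewrite card_imset ?card_ord.
have /forall_inPn[_ /imsetP[i0 _ ->] /forall_inPn[v]] : ~~ cut B' (f @: 'I_k).
  apply/negP=> /indB'[] ES; move: cardS; rewrite ES ?cards0 ?cardsT ?card_ord; lia.
rewrite inE => fv nzv.
pose f' i := if unlift ord_max i is Some j then f j else v.
have f'max : f' ord_max = v by rewrite /f' unlift_none.
have f'lift i : f' (lift ord_max i) = f i by rewrite /f' liftK.
have injf' : injective f'.
  move=> i j; case: (unliftP ord_max i) (unliftP ord_max j) => [i'|] -> [j'|] ->;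
    rewrite ?f'max ?f'lift // => Ef.
  - by rewrite (injf _ _ Ef).
  - by rewrite -Ef imset_f in fv.
  by rewrite Ef imset_f in fv.
pose c := [seq B' (f i) v | i <- enum 'I_k].
have cE (i : 'I_k) : c`_i = B' (f i) v.
  by rewrite (nth_map i) ?size_enum_ord // nth_ord_enum.
have size_c : size c = k by rewrite size_map size_enum_ord.
have extB : mxsub f' f' B' = fun_mx k.+1 (extension_fun k c).
  apply/matrixP=> i j; rewrite !mxE /extension_fun.
  case: (unliftP ord_max i) (unliftP ord_max j) => [i'|] -> [j'|] ->;
    rewrite ?f'max ?f'lift ?lift_max /= ?eqxx ?(ltn_eqF (ltn_ord _)) ?cE //.
  - by have /matrixP/(_ i' j') := Bf; rewrite !mxE.
  by rewrite nth_default ?size_c // oppr0; have := skB' v v; lia.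
have [|||k4 [ks' [p [injp pathp]]]] := @extension_path k c k14.
- rewrite mem_sign_words size_c eqxx; apply/allP=> _ /mapP[i _ ->].
  by have := B'1 (f i) v; rewrite !inE; lia.
- by apply/allPn; exists (B' (f i0) v) => //; apply: map_f; rewrite mem_enum.
- by rewrite -extB; apply: two_maximal_mxsub.
split=> //; exists (ks ++ map f' ks'), (f' \o p); split; first exact: inj_comp.
rewrite -pathp mutations_cat -extB mutations_mxsub //.
by apply/matrixP=> i j; rewrite !mxE.
Qed.

Lemma has_full_path n (B : 'M[int]_n) : skew_symmetric B -> indecomposable B ->
  two_maximal C B -> (forall ks i j, `|mutations B ks i j| <= 1) ->
  (0 < n)%N -> (n <= 4)%N /\ has_path B n.
Proof.
move=> skB indB mB B1 n0.
suff path k : (k.+1 <= n)%N -> (k.+1 <= 4)%N /\ has_path B k.+1.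
  by case: n n0 {skB indB mB B1} B path => // n _ B; apply.
elim: k => [_ | k IHk kn].
  split=> //; exists [::], (fun=> Ordinal n0); split=> [i j _|].
    by rewrite !ord1.
  apply/matrixP=> i j; rewrite !ord1 !mxE /=.
  by have := skB (Ordinal n0) (Ordinal n0); rewrite /linear_fun /=; lia.
by have [k4 pathk] := IHk (ltnW kn); apply: has_path_step.
Qed.
End Growth.

(** * The classification *)

Lemma linear_skew n : skew_symmetric (fun_mx n linear_fun).
Proof. by move=> i j; rewrite !mxE opprB. Qed.

Lemma linear_orientation n :
  is_orientation (path_graph n) (quiver_of_mx (@linear_skew n)).
Proof. by apply/matrixP=> i j; rewrite !mxE /linear_fun; lia. Qed.

Theorem theorem4p14 (R : realType) (n : nat) (Q : cluster_quiver n)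
    (Q_connected : quiver_connected Q) :
  r_maximal (2 : R) Q <->
  (exists2 Q' : cluster_quiver 2, is_orientation X2_graph Q' &
     mutation_equivalent Q Q') \/
  (exists (m : nat) (Q' : cluster_quiver m),
     [/\ (1 <= m <= 4)%N, is_orientation (path_graph m) Q' &
         mutation_equivalent Q Q']).
Proof.
split=> [/r_maximal_mxP mQ | eqQ].
  have skQ : skew_symmetric (exchange_mx Q) by move=> i j; exact: exchange_mx_skew.
  have indQ := connected_indecomposable Q_connected.
  have [[ks [i [j Bij]]] | B1] :=
    boolp.EM (exists ks i j, 1 < `|mutations (exchange_mx Q) ks i j|).
    left; have [n2 B2] := multiple_arrow (mutations_skew ks skQ)
      (indecomposable_mutations (ks := ks) indQ) (mQ ks) Bij.
    subst n; exists (foldl (@mutation 2) Q ks); last first.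
      by exists ks, id => //; exists id.
    rewrite -exchange_mx_mutations in B2.
    set Q' := foldl _ _ _ in B2 *; apply/matrixP=> k l; rewrite !mxE.
    have [-> | /B2] := eqVneq k l; first by rewrite no_loop.
    by rewrite mxE; have := no_2cycle Q' k l; lia.
  right; have [n0 _] := Q_connected.
  have {}B1 ks i j : `|mutations (exchange_mx Q) ks i j| <= 1.
    by rewrite leNgt; apply/negP=> Bij; apply: B1; exists ks, i, j.
  have [n4 [ks [f [injf pathf]]]] := has_full_path skQ indQ mQ B1 n0.
  exists n, (quiver_of_mx (@linear_skew n)); split; first by rewrite n0.
    exact: linear_orientation.
  exists ks; apply/quiver_isoP; rewrite exchange_mx_mutations quiver_of_mxK -pathf.
  have [g fK gK] := injF_bij injf; exists g; first by exists f.
  by apply/matrixP=> k l; rewrite !mxE !gK.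
apply/r_maximal_mxP; case: eqQ => [[Q' Q'X2 eqQ] | [m [Q' [m14 Q'path eqQ]]]].
  apply: two_maximal_equivalent eqQ _; apply: double_arrow_two_maximal.
    by move=> i j; exact: exchange_mx_skew.
  by rewrite (orientation_entry _ _ Q'X2) mxE.
by apply: two_maximal_equivalent eqQ _; apply: path_two_maximal Q'path.
Qed.
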